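(* Let $p$ be a prime and let $g$ be a positive integer with $\gcd(g,p)=1$. Then $$N_g(3) \leq \frac34\, p + \frac{g^{2g+1}+g+1}{4}.$$
   Context: For a prime $p$ and an integer $g$ with $\gcd(g,p)=1$, the function $f_g$ is defined on nonnegative integers $u$ by the conditions $f_g(u) \equiv g^u \pmod p$ and $0 \leq f_g(u) \leq p-1$. For an initial value $u_0$ consider the sequence $u_n = f_g(u_{n-1})$, $n = 1,2,\ldots$. For a positive integer $k$, $N_g(k)$ denotes the number of $u_0 \in \{1,\ldots,p-1\}$ for which $u_k = u_0$. In particular, $N_g(3)$ is the number of $u \in \{1,\ldots,p-1\}$ with $f_g(f_g(f_g(u)))=u$. *)

(* Defs.v *)
From mathcomp Require Import all_boot all_order all_algebra.

Set Implicit Arguments.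
Unset Strict Implicit.
Unset Printing Implicit Defensive.

Definition fexp (p g u : nat) : nat := (g ^ u) %% p.

(* [iter k (fexp p g) u] is the term u_k of the orbit with u_0 = u. *)
Definition numPeriodic (p g k : nat) : nat :=
  #|[set u : 'I_p | (1 <= u) && (iter k (fexp p g) u == u :> nat)]|.

(* Main.v *)
(** Let f = f_g, S u = u + 1 and M u = g u. Then f S = M f and M S = S^g M, and
    f M f^-1 acts on residues as T z = g^-k z^g with 0 <= k < g depending on z.
    At points where f^3 = 1 these relations give S T = T^g S: if x, x + 1, g x
    and g (x + 1) are all 3-periodic, then z = f (f x) satisfies
    c1 z^g + 1 = c2 (z + 1)^(g^g), where (c1, c2) takes at most g * g^g values.
    For g > 1 this leaves at most g^(2 g + 1) values of z, hence of x, so the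
    complement of the set of periodic points cannot be much smaller than p / 4.
    Wrap-around modulo p costs the remaining g + 1. The argument needs f to be
    injective; otherwise g is not a primitive root and the bound is clear. *)
Require Import Defs.
From mathcomp Require Import all_boot all_order all_algebra.
From mathcomp Require Import finfield zify lra.
Import Order.TTheory GRing.Theory Num.Theory.
Local Open Scope ring_scope.

(** All points of [E] are roots of the product of the family, a nonzero polynomial of degree at most
    [d * size qs]. *)
Lemma card_roots_leq (F : finFieldType) (E : {set F}) (qs : seq {poly F})
    (d : nat) :
  (forall q, q \in qs -> q != 0 /\ (size q <= d.+1)%N) ->
  (forall x, x \in E -> exists2 q, q \in qs & root q x) ->
  (#|E| <= d * size qs)%N.
Proof.
move=> qsP Eqs; pose Q := \prod_(q <- qs) q.
have /andP[Q0 szQ] : (Q != 0) && (size Q <= (d * size qs).+1)%N.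
  rewrite /Q; elim: qs qsP {Eqs Q} => [|q s IHs] qsP.
    by rewrite big_nil oner_eq0 size_poly1 muln0.
  have [q0 szq] := qsP q (mem_head _ _).
  have /andP[s0 szs] : (\prod_(r <- s) r != 0) &&
      (size (\prod_(r <- s) r)%R <= (d * size s).+1)%N.
    by apply: IHs => r rs; apply: qsP; rewrite inE rs orbT.
  rewrite big_cons mulf_neq0 //=; apply: leq_trans (size_polyMleq _ _) _.
  rewrite mulnS -subn1 leq_subLR add1n -addnS -addSn; exact: leq_add.
rewrite cardE -ltnS; apply: leq_trans szQ; apply: max_poly_roots Q0 _ _.
  apply/allP => x; rewrite mem_enum => /Eqs[q qs_q qx].
  by rewrite /Q (big_rem q) //= rootM qx.
exact: enum_uniq.
Qed.

Section RepeatedExponentiation.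

Variables p g : nat.
Hypotheses (p_pr : prime p) (cgp : coprime g p).

Local Notation F := 'F_p.
Local Notation f := (fexp p g).
Local Notation gam := (g%:R : F).

(** * Arithmetic of [f] in the prime field *)

Lemma ltn_Fp (x : F) : (x < p)%N.
Proof. by rewrite -[X in (_ < X)%N](Fp_cast p_pr) ltn_ord. Qed.

Lemma natF_inj (a b : nat) :
  (a < p)%N -> (b < p)%N -> a%:R = b%:R :> F -> a = b.
Proof.
move=> ap bp /(congr1 (fun x : F => nat_of_ord x)).
by rewrite !val_Fp_nat // !modn_small.
Qed.

Lemma gam_neq0 : gam != 0.
Proof.
by rewrite -(dvdn_pcharf (pchar_Fp p_pr)) -prime_coprime // coprime_sym.
Qed.

Lemma ltn_fexp u : (f u < p)%N.
Proof. by rewrite ltn_pmod ?prime_gt0. Qed.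

Lemma fexpE u : (f u)%:R = gam ^+ u.
Proof. by rewrite /fexp Fp_nat_mod // natrX. Qed.

Lemma fexp_gt0 u : (0 < f u)%N.
Proof.
rewrite lt0n; apply/eqP => fu0; have := expf_neq0 u gam_neq0.
by rewrite -fexpE fu0 eqxx.
Qed.

Lemma expF_p (x : F) : x ^+ p = x.
Proof. by rewrite -{2}(expf_card x) card_Fp. Qed.

Lemma expF_predp (x : F) : x != 0 -> x ^+ p.-1 = 1.
Proof.
move=> x0; apply: (mulfI x0).
by rewrite mulr1 -exprS prednK ?prime_gt0 // expF_p.
Qed.

Lemma fexp_predp : f p.-1 = 1%N.
Proof.
apply: natF_inj; rewrite ?ltn_fexp ?prime_gt1 //.
by rewrite fexpE expF_predp ?gam_neq0.
Qed.

(* Shifting [a] multiplies [f a] by [g], up to a multiple [k * p] with [k < g];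
   hence it raises [f (f a)] to the power [g], up to the factor [g ^ - k]. *)
Lemma fexp2S a :
  exists2 k, (k < g)%N & (f (f a.+1))%:R = gam ^- k * (f (f a))%:R ^+ g.
Proof.
exists (g * f a %/ p)%N.
  rewrite ltn_divLR ?prime_gt0 // ltn_mul2l ltn_fexp andbT lt0n.
  by apply: contraNneq gam_neq0 => ->.
have fS : f a.+1 = (g * f a %% p)%N by rewrite /fexp expnS modnMmr.
rewrite !fexpE -exprM fS.
(* Since [gam ^+ p = gam], the carry [k * p] in the exponent contributes just [gam ^+ k]. *)
rewrite [(f a * g)%N]mulnC [X in _ * gam ^+ X](divn_eq _ p) exprD exprM expF_p.
by rewrite mulKf // expf_neq0 ?gam_neq0.
Qed.

(** Each use of [fexp2S] turns a factor [c] into one of the [g] values [gam ^- k * c ^+ g]. The list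
    does not depend on [a], so a fixed finite family of equations will serve all points. *)
Lemma fexp2D j : exists cs : seq F,
  [/\ size cs = (g ^ j)%N, 0 \notin cs &
      forall a, exists2 c, c \in cs &
        (f (f (a + j)))%:R = c * (f (f a))%:R ^+ (g ^ j)].
Proof.
elim: j => [|j [cs [szcs cs0 csP]]].
  exists [:: 1]; split=> [//||a]; first by rewrite inE eq_sym oner_eq0.
  by exists 1; rewrite ?inE // addn0 mul1r expr1.
exists [seq gam ^- k * c ^+ g | c <- cs, k <- iota 0 g]; split.
- by rewrite size_allpairs szcs size_iota expnS mulnC.
- apply/negP => /allpairsP[[c k] /= [ccs _ /esym/eqP]].
  rewrite mulf_eq0 invr_eq0 !expf_eq0 (negPf gam_neq0) andbF /=.
  by case/andP=> _ /eqP c0; rewrite -c0 ccs in cs0.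
move=> a; have [c ccs Ec] := csP a; have [k kg Ek] := fexp2S (a + j).
exists (gam ^- k * c ^+ g).
  by apply: (allpairs_f (fun c k => gam ^- k * c ^+ g)); rewrite // mem_iota.
by rewrite addnS Ek Ec exprMn -exprM mulrA expnSr.
Qed.

(** * Counting 3-periodic points *)

Definition periodic3 : {set F} :=
  [set x : F | (0 < x)%N && (f (f (f x)) == x :> nat)].

Lemma numPeriodic3_leq : (numPeriodic p g 3 <= #|periodic3|)%N.
Proof.
rewrite /numPeriodic -(card_imset (f := fun u : 'I_p => (u : nat)%:R : F)).
  apply/subset_leq_card/subsetP=> _ /imsetP[u uP ->].
  by move: uP; rewrite !inE val_Fp_nat // modn_small.
by move=> u v /natF_inj uv; apply/val_inj/uv.
Qed.

(* If [f] is not injective then [g] is not a primitive root, so the image of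
   [f], which contains every periodic point, has at most [(p - 1) / 2]
   elements. *)
Lemma periodic3_noninj u v :
  (0 < u < v)%N -> (v < p)%N -> f u = f v -> (2 * #|periodic3| <= p)%N.
Proof.
move=> /andP[u0 uv] vp fuv; pose d := (v - u)%N.
have gd : gam ^+ d = 1.
  apply: (mulfI (expf_neq0 u gam_neq0)).
  by rewrite mulr1 -exprD subnKC ?(ltnW uv) // -!fexpE fuv.
pose e := gcdn d p.-1.
have d0 : (0 < d)%N by rewrite subn_gt0.
have ge : gam ^+ e = 1.
  rewrite /e; case: (egcdnP p.-1 d0) => km kn Ekm _.
  have: gam ^+ (km * d) = 1 by rewrite mulnC exprM gd expr1n.
  by rewrite Ekm exprD mulnC exprM expF_predp ?gam_neq0 // expr1n mul1r.
have e0 : (0 < e)%N by rewrite gcdn_gt0 d0.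
(* [e] divides [p.-1] and is at most [d <= p - 2], so it is a proper divisor. *)
have e_le : (2 * e <= p)%N.
  have /dvdnP[m Em] : (e %| p.-1)%N by apply: dvdn_gcdr.
  have : (e <= d)%N by rewrite dvdn_leq ?dvdn_gcdl.
  rewrite /d in d0 *; case: m Em => [|[|m]]; nia.
apply: leq_trans e_le; rewrite leq_mul2l /=.
have := leq_imset_card (fun j : 'I_e => gam ^+ j) [set: 'I_e].
rewrite cardsT card_ord; apply: leq_trans.
apply/subset_leq_card/subsetP => x; rewrite inE => /andP[_ /eqP fx].
apply/imsetP; exists (Ordinal (ltn_pmod (f (f x)) e0)); rewrite ?inE //=.
have xE : x = gam ^+ f (f x) by rewrite -fexpE fx natr_Zp.
rewrite [LHS]xE [in LHS](divn_eq (f (f x)) e) exprD mulnC exprM ge.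
by rewrite expr1n mul1r.
Qed.

Lemma periodic3_g1 : g = 1%N -> (#|periodic3| <= 1)%N.
Proof.
move=> g1; rewrite -(cards1 (1 : F)); apply/subset_leq_card/subsetP => x.
rewrite !inE => /andP[_ /eqP fx]; rewrite -[x]natr_Zp -fx fexpE g1.
by rewrite expr1n.
Qed.

(** Both sides lie between 1 and [p.-1] and [f] sends both to [gam * x]. As [f p.-1 = 1], the
    condition [x != 1] keeps [(f (f x)).+1] below [p]. *)
Lemma fexp2_mul (x : F) :
  {in [pred u | 0 < u < p]%N &, injective f} ->
  x \in periodic3 -> gam * x \in periodic3 -> x != 1 ->
  f (f (gam * x)%R) = (f (f x)).+1.
Proof.
move=> f_inj; rewrite !inE => /andP[_ /eqP fx] /andP[_ /eqP fgx] x1.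
apply: f_inj; rewrite ?inE ?fexp_gt0 ?ltn_fexp //=.
  have ffxp : (f (f x) < p)%N by apply: ltn_fexp.
  rewrite ltn_neqAle ffxp andbT; apply: contraNneq x1 => ffxE.
  have {}ffxE : f (f x) = p.-1.
    by apply: succn_inj; rewrite ffxE prednK ?prime_gt0.
  by rewrite -[x]natr_Zp -fx ffxE fexp_predp.
apply: natF_inj; rewrite ?ltn_fexp //.
by rewrite fgx natr_Zp fexpE exprS -fexpE fx natr_Zp.
Qed.

(** Each [x] lies in [G], or equals 1, or has [gam * x] in [D], or has one of its four companions
    outside [A]. Hence [p] is at most [g ^ (2 * g + 1) + 4 * (p - #|A|) + g + 1]. *)
Lemma card_periodic3_inj : (1 < g)%N ->
  {in [pred u | 0 < u < p]%N &, injective f} ->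
  (4 * #|periodic3| <= 3 * p + (g ^ (2 * g + 1) + g + 1))%N.
Proof.
move=> g1 f_inj; set A := periodic3.
pose B := [set x : F | [&& x \in A, x + 1 \in A, gam * x \in A &
  gam * (x + 1) \in A]].
pose D := [set y : F | (p <= y + g)%N].
pose G := [set x in B | (x != 1) && (gam * x \notin D)].
have cardG : (#|G| <= g ^ (2 * g + 1))%N.
  have [cs1 [szcs1 cs1_0 cs1P]] := fexp2D 1.
  have [cs2 [szcs2 cs2_0 cs2P]] := fexp2D g.
  pose h (x : F) : F := (f (f x))%:R.
  (* A third application of [f] recovers [x]. *)
  have h_inj : {in G &, injective h}.
    move=> x y; rewrite !inE => /andP[/andP[/andP[_ /eqP fx] _] _].
    move=> /andP[/andP[/andP[_ /eqP fy] _] _] /natF_inj.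
    by rewrite !ltn_fexp => /(_ isT isT) hxy; apply: val_inj; rewrite /= -fx hxy.
  rewrite -(card_in_imset h_inj).
  (* With [z = h x], the two terms come from computing [f (f (gam * (x + 1)))] as
     [f (f (x + 1)) + 1] and by [g] shifts from [gam * x], where [f (f (gam * x))] is [z + 1]. *)
  pose q c1 c2 : {poly F} := c1 *: 'X^g + 1 - c2 *: ('X + 1) ^+ (g ^ g).
  have -> : (g ^ (2 * g + 1) = g ^ g * size [seq q c1 c2 | c1 <- cs1, c2 <- cs2])%N.
    by rewrite size_allpairs szcs1 szcs2 -!expnD; congr expn; lia.
  apply: card_roots_leq => [_ /allpairsP[[c1 c2] /= [c1P c2P ->]]|].
    have c20 : c2 != 0 by apply: contraNneq cs2_0 => <-.
    (* This uses [1 < g]; the second term of [q] then fixes its degree. *)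
    have ggg : (g < g ^ g)%N by apply: ltn_expl.
    suff: size (q c1 c2) = (g ^ g).+1.
      by move=> szq; rewrite -size_poly_eq0 szq.
    have szr : size (c2 *: ('X + 1) ^+ (g ^ g) : {poly F}) = (g ^ g).+1.
      rewrite size_scale //.
      have -> : 'X + 1 = 'X - (-1)%:P :> {poly F} by rewrite polyCN opprK.
      by rewrite size_exp_XsubC.
    rewrite /q addrC size_polyDl size_polyN szr //.
    apply: leq_ltn_trans (size_polyD _ _) _; rewrite size_poly1 gtn_max.
    rewrite [(1 < _)%N]ltnS expn_gt0 (ltnW g1) andbT.
    apply: leq_ltn_trans (size_scale_leq _ _) _.
    by rewrite size_polyXn ltnS.
  move=> _ /imsetP[x xG ->].
  (* [gx_lt] excludes the wrap-around of g x + g modulo p. *)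
  move: xG; rewrite [x \in G]inE [x \in B]inE [gam * x \in D]inE -ltnNge.
  case/andP=> /and4P[xA x1A gxA gx1A] /andP[x_neq1 gx_lt].
  have pos_neq0 (y : F) : y \in A -> y != 0.
    by rewrite inE => /andP[y0 _]; apply: contraTneq y0 => ->.
  (* No wrap-around here: [x + 1] is periodic, hence nonzero in [F]. *)
  have x1E : (x + 1)%R = (x + 1)%N :> nat.
    have xp : (x.+1 < p)%N.
      rewrite ltn_neqAle ltn_Fp andbT; apply: contraNneq (pos_neq0 _ x1A) => xp.
      by rewrite -[x]natr_Zp natr1 -(dvdn_pcharf (pchar_Fp p_pr)) xp.
    by apply: natF_inj; rewrite ?ltn_Fp ?addn1 // -natr1 !natr_Zp.
  have gx1E : (gam * (x + 1))%R = ((gam * x)%R + g)%N :> nat.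
    apply: natF_inj; rewrite ?ltn_Fp //.
    by rewrite natr_Zp mulrDr mulr1 natrD natr_Zp.
  have [c1 c1P Ec1] := cs1P x; have [c2 c2P Ec2] := cs2P (gam * x)%R.
  exists (q c1 c2); first exact: allpairs_f.
  have x1_neq1 : x + 1 != 1 by rewrite -subr_eq0 addrK pos_neq0.
  apply/rootP; rewrite /q !hornerE /= -/(h x).
  move: Ec2; rewrite -gx1E !(fexp2_mul _ f_inj) // x1E.
  rewrite -!natr1 Ec1 -/(h x) expn1 => ->.
  by rewrite subrr.
have shift_inj : injective (fun x : F => x + 1) by apply: addIr.
have scale_inj : injective (fun x : F => gam * x) by apply: mulfI gam_neq0.
have comp_inj : injective (fun x : F => gam * (x + 1)).
  by move=> x y /scale_inj/shift_inj.
have cardCA (h : F -> F) : injective h -> #|h @^-1: (~: A)| = (p - #|A|)%N.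
  by move=> h_inj; rewrite card_preimset // cardsCs setCK card_Fp.
(* [D] consists of residues [p.-1 - j] with [j < g]. *)
have cardD : (#|((fun x : F => gam * x) @^-1: D)%R| <= g)%N.
  rewrite card_preimset //.
  have := leq_imset_card (fun j : 'I_g => (p.-1 - j)%:R : F) [set: 'I_g].
  rewrite cardsT card_ord; apply: leq_trans.
  apply/subset_leq_card/subsetP => y; rewrite inE => yg.
  have yp := ltn_Fp y; have jg : (p.-1 - y < g)%N by lia.
  apply/imsetP; exists (Ordinal jg); rewrite ?inE //=.
  by rewrite subKn ?natr_Zp //; lia.
have cover : [set: F] \subset G :|: ~: A :|: (fun x : F => x + 1) @^-1: (~: A)
    :|: (fun x : F => gam * x) @^-1: (~: A)
    :|: (fun x : F => gam * (x + 1)) @^-1: (~: A)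
    :|: (fun x : F => gam * x) @^-1: D :|: [set 1].
  apply/subsetP => x _.
  rewrite /G /B; move: (A) (D) => A' D'; rewrite !inE.
  by do 4![case: (_ \in A')] => //; case: (_ \in D'); case: eqP.
have := subset_leq_card cover; rewrite cardsT card_Fp //.
have := cardCA id (@inj_id F); have := cardCA _ shift_inj.
have := cardCA _ scale_inj; have := cardCA _ comp_inj.
have := max_card A; rewrite card_Fp //.
have -> : id @^-1: (~: A) = ~: A by apply/setP => x; rewrite inE.
have leU (X Y : {set F}) (m n : nat) :
    (#|X| <= m -> #|Y| <= n -> #|X :|: Y| <= m + n)%N.
  by move=> Xm Yn; apply: leq_trans (leq_card_setU _ _) (leq_add Xm Yn).
move=> Ap cA1 cA2 cA3 cA4 le_p.
have := leq_trans le_p (leU _ _ _ _ (leU _ _ _ _ (leU _ _ _ _ (leU _ _ _ _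
  (leU _ _ _ _ (leU _ _ _ _ cardG (eq_leq cA4)) (eq_leq cA3)) (eq_leq cA2))
  (eq_leq cA1)) cardD) (eq_leq (cards1 _))).
(* [Ap] makes the truncated subtraction [p - #|A|] exact. *)
by move: Ap; move: #|A| (g ^ _)%N => a b; lia.
Qed.

(** If at most half of the residues are periodic, the bound is immediate; otherwise
    [periodic3_noninj] forces [f] to be injective. The case [g = 1] has at most one periodic
    point. *)
Lemma card_periodic3 : (0 < g)%N ->
  (4 * #|periodic3| <= 3 * p + (g ^ (2 * g + 1) + g + 1))%N.
Proof.
rewrite leq_eqVlt => /predU1P[/esym g1 | g1].
  have := periodic3_g1 g1; have := prime_gt1 p_pr.
  by rewrite g1 exp1n; move: #|_| => a; lia.
have [small | big] := leqP (2 * #|periodic3|) p.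
  by move: small; move: #|_| (g ^ _)%N => a b; lia.
have f_neq u v : (0 < u)%N -> (u < v)%N -> (v < p)%N -> f u <> f v.
  move=> u0 uv vp fuv; move: big; rewrite ltnNge => /negP; apply.
  by apply: (@periodic3_noninj u v) fuv; rewrite ?u0.
apply: card_periodic3_inj g1 _ => u v /andP[u0 up] /andP[v0 vp] fuv.
have [uv | vu | //] := ltngtP u v; first by case: (f_neq _ _ u0 uv vp fuv).
by case: (f_neq _ _ v0 vu up (esym fuv)).
Qed.

End RepeatedExponentiation.

Theorem theorem6 (p g : nat) (hp : prime p) (hg : (0 < g)%N)
    (hgp : coprime g p) :
  (numPeriodic p g 3)%:R <=
    3 / 4 * p%:R + (g%:R ^+ (2 * g + 1) + g%:R + 1) / 4 :> rat.
Proof.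
have : (4 * numPeriodic p g 3 <= 3 * p + (g ^ (2 * g + 1) + g + 1))%N.
  apply: leq_trans (card_periodic3 p g hp hgp hg).
  by rewrite leq_mul2l numPeriodic3_leq.
rewrite -natrX; move: (g ^ _)%N (numPeriodic _ _ _) => b n.
rewrite -(ler_nat rat) natrM [X in _ <= X]natrD [(3 * p)%:R]natrM !natrD; lra.
Qed.
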